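(* Let $(A,\prec_A,\succ_A)$ and $(A^*,\prec_{A^*},\succ_{A^*})$ be noncommutative Novikov algebras, where $A^*$ is the dual space of $A$. Let $\Delta_{\prec_A},\Delta_{\succ_A}:A\to A\otimes A$ be the linear duals of $\prec_{A^*},\succ_{A^*}$ respectively. Then the following statements are equivalent: (a) There is a Manin triple of noncommutative Novikov algebras $\big((A\oplus A^*,\prec_{A\bowtie A^*},\succ_{A\bowtie A^*},\mathfrak B_d),(A,\prec_A,\succ_A),(A^*,\prec_{A^*},\succ_{A^*})\big)$. (b) The decuple $(A,A^*,-R^*_{\bullet_A},L^*_{\succ_A},R^*_{\prec_A},-L^*_{\bullet_A},-R^*_{\bullet_{A^*}},L^*_{\succ_{A^*}},R^*_{\prec_{A^*}},-L^*_{\bullet_{A^*}})$ is a matched pair of noncommutative Novikov algebras. (c) The quintuple $(A,\prec_A,\succ_A,\Delta_{\prec_A},\Delta_{\succ_A})$ is a noncommutative Novikov bialgebra.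
   Context: $\mathbf k$ is a field of characteristic $0$; all vector spaces are finite-dimensional over $\mathbf k$, tensor products are over $\mathbf k$, and $A^{**}$ is identified with $A$. A noncommutative Novikov algebra is a vector space $A$ with bilinear operations $\prec,\succ$ such that, with $\bullet:=\prec+\succ$, $(x\succ y)\prec z=x\succ(y\prec z)$ and $(x\prec y)\bullet z=x\bullet(y\succ z)$ for all $x,y,z\in A$. For a bilinear operation $\circ$ put $L_\circ(x)y=x\circ y=R_\circ(y)x$. For $\rho:A\to\mathrm{End}(V)$ linear, $\rho^*:A\to\mathrm{End}(V^* )$ is defined by $\langle\rho^*(x)u^*,v\rangle=\langle u^*,\rho(x)v\rangle$. The linear dual of an operation $\circ$ on $A^*$ is $\Delta:A\to A\otimes A$ with $\langle a^*\otimes b^*,\Delta(x)\rangle=\langle a^*\circ b^*,x\rangle$. Let $\sigma(x\otimes y)=y\otimes x$. Matched pair: let $(A,\prec_A,\succ_A)$, $(B,\prec_B,\succ_B)$ be noncommutative Novikov algebras and $\ell_{\prec_A},r_{\prec_A},\ell_{\succ_A},r_{\succ_A}:A\to\mathrm{End}(B)$, $\ell_{\prec_B},r_{\prec_B},\ell_{\succ_B},r_{\succ_B}:B\to\mathrm{End}(A)$ linear maps. For $*\in\{\prec,\succ\}$ define on $A\oplus B$ $$(x+a)*_{A\bowtie B}(y+b):=\big(x*_Ay+r_{*_B}(b)x+\ell_{*_B}(a)y\big)+\big(a*_Bb+\ell_{*_A}(x)b+r_{*_A}(y)a\big).$$ If $(A\oplus B,\prec_{A\bowtie B},\succ_{A\bowtie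 B})$ is a noncommutative Novikov algebra, then $(A,B,\ell_{\prec_A},r_{\prec_A},\ell_{\succ_A},r_{\succ_A},\ell_{\prec_B},r_{\prec_B},\ell_{\succ_B},r_{\succ_B})$ (in this order) is called a matched pair of noncommutative Novikov algebras. A bilinear form $\mathfrak B$ on a noncommutative Novikov algebra is invariant if $\mathfrak B(x\prec y,z)=-\mathfrak B(y,z\bullet x)=\mathfrak B(x,y\succ z)$ for all $x,y,z$. A Manin triple of noncommutative Novikov algebras $\big((A\oplus A^*,\prec_{A\bowtie A^*},\succ_{A\bowtie A^*},\mathfrak B_d),(A,\prec_A,\succ_A),(A^*,\prec_{A^*},\succ_{A^*})\big)$ is a noncommutative Novikov algebra structure on $A\oplus A^*$ that contains $(A,\prec_A,\succ_A)$ and $(A^*,\prec_{A^*},\succ_{A^*})$ as subalgebras and for which the form $\mathfrak B_d(x+a^*,y+b^* ):=\langle a^*,y\rangle+\langle x,b^*\rangle$ is invariant. A noncocommutative Novikov coalgebra is $(A,\Delta_\prec,\Delta_\succ)$ with linear maps $\Delta_\prec,\Delta_\succ:A\to A\otimes A$ such that, with $\Delta_\bullet:=\Delta_\prec+\Delta_\succ$, $(\Delta_\succ\otimes\mathrm{id})\Delta_\prec=(\mathrm{id}\otimes\Delta_\prec)\Delta_\succ$ and $(\Delta_\prec\otimes\mathrm{id})\Delta_\bullet=(\mathrm{id}\otimes\Delta_\succ)\Delta_\bullet$. A noncommutative Novikov bialgebra is $(A,\prec,\succ,\Delta_\prec,\Delta_\succ)$ where $(A,\prec,\succ)$ is a noncommutative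 Novikov algebra, $(A,\Delta_\prec,\Delta_\succ)$ is a noncocommutative Novikov coalgebra, and for all $x,y\in A$: $\Delta_\prec(x\prec y)=(R_\prec(y)\otimes\mathrm{id})\Delta_\prec(x)+(\mathrm{id}\otimes L_\bullet(x))\Delta_\bullet(y)$; $\Delta_\succ(x\succ y)=(R_\bullet(y)\otimes\mathrm{id})\Delta_\bullet(x)+(\mathrm{id}\otimes L_\succ(x))\Delta_\succ(y)$; $(\mathrm{id}\otimes R_\prec(y))\Delta_\bullet(x)+\sigma\big((\mathrm{id}\otimes R_\prec(x))\Delta_\bullet(y)\big)=(L_\succ(y)\otimes\mathrm{id})\Delta_\bullet(x)+\sigma\big((L_\succ(x)\otimes\mathrm{id})\Delta_\bullet(y)\big)$; $(L_\bullet(y)\otimes\mathrm{id})\Delta_\prec(x)+\sigma\big((L_\bullet(x)\otimes\mathrm{id})\Delta_\prec(y)\big)=(\mathrm{id}\otimes R_\bullet(y))\Delta_\succ(x)+\sigma\big((\mathrm{id}\otimes R_\bullet(x))\Delta_\succ(y)\big)$. *)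

(* Defs.v *)
From HB Require Import structures.
From mathcomp Require Import all_boot all_order all_algebra.

Set Implicit Arguments.
Unset Strict Implicit.
Unset Printing Implicit Defensive.

Import GRing.Theory.
Local Open Scope ring_scope.

Section Bilinear.
Variable K : fieldType.
Implicit Types U V W : vectType K.

Definition bilinear_fun U V W (f : U -> V -> W) : Prop :=
  (forall x, linear (f x)) /\ (forall y, linear (f^~ y)).

(* [linfun] only agrees with its argument when that argument is linear, so
   [bilin f] is meant for f satisfying [bilinear_fun]; see [bilinE]. *)
Definition bilin U V W (f : U -> V -> W) : 'Hom(U, 'Hom(V, W)) :=
  linfun (fun x => linfun (f x)).

Lemma linfunE_of U V (f : U -> V) : linear f -> linfun f =1 f.
Proof.
move=> lf; pose m := GRing.isLinear.Build K U V _ f lf.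
pose F : {linear U -> V} := HB.pack f m.
exact: (lfunE F).
Qed.

Lemma bilinE U V W (f : U -> V -> W) :
  bilinear_fun f -> forall x y, bilin f x y = f x y.
Proof.
move=> [lr ll] x y; rewrite /bilin linfunE_of ?linfunE_of // => c u v.
by apply/lfunP => z; rewrite add_lfunE scale_lfunE !linfunE_of // ll.
Qed.

Lemma hom_bilinear U V W (f : 'Hom(U, 'Hom(V, W))) : bilinear_fun (fun x => f x).
Proof.
split=> [x|y] c u v; first exact: linearP.
by rewrite linearP add_lfunE scale_lfunE.
Qed.

End Bilinear.

Section Dual.
Variable K : fieldType.
Implicit Types A U V W : vectType K.

Definition dual V : vectType K := 'Hom(V, K^o).

Definition pairing V (u : dual V) (v : V) : K := (u : 'Hom(V, K^o)) v.

Lemma pairing_bilinear V : bilinear_fun (fun (u : dual V) (v : V) => pairing u v : K^o).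
Proof.
split=> [u|v] c s t; rewrite /pairing; first exact: linearP.
by rewrite add_lfunE scale_lfunE.
Qed.

Lemma dualP V (u w : dual V) : (forall v, pairing u v = pairing w v) -> u = w.
Proof. by move=> h; apply/lfunP. Qed.

Definition ev V : 'Hom(V, dual (dual V)) :=
  bilin (fun (v : V) (u : dual V) => pairing u v : K^o).

Lemma evE V v (u : dual V) : pairing (ev V v) u = pairing u v.
Proof.
rewrite /pairing /ev bilinE //; case: (pairing_bilinear V) => h1 h2.
by split=> [x|y]; [exact: h2|exact: h1].
Qed.

Lemma ev_lker0 V : lker (ev V) == 0%VS.
Proof.
apply/lker0P => v w evw.
rewrite (coord_vbasis (memvf v)) (coord_vbasis (memvf w)).
apply: eq_bigr => i _; congr (_ *: _).
pose f (x : V) : K^o := coord (vbasis fullv) i x.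
have lf : linear f by move=> c x y; rewrite /f linearP.
have := congr1 (fun e => pairing e (linfun f : dual V)) evw.
by rewrite !evE /pairing /= !linfunE_of.
Qed.

Lemma dim_dual V : dim (dual V) = dim V.
Proof. exact: muln1. Qed.

Lemma ev_limg V : limg (ev V) = fullv.
Proof.
apply/eqP; rewrite eqEdim subvf /= limg_dim_eq.
  by rewrite !dimvf !dim_dual.
by rewrite (eqP (ev_lker0 V)) capv0.
Qed.

Lemma evVK V : cancel (ev V)^-1%VF (ev V).
Proof. by move=> e; apply: limg_lfunVK; rewrite ev_limg memvf. Qed.

Lemma evK V : cancel (ev V) (ev V)^-1%VF.
Proof. exact/lker0_lfunK/ev_lker0. Qed.

Definition rdual A V (rho : 'Hom(A, 'End(V))) : 'Hom(A, 'End(dual V)) :=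
  bilin (fun (x : A) (u : dual V) => ((u : 'Hom(V, K^o)) \o rho x)%VF : dual V).

Lemma rdualE A V (rho : 'Hom(A, 'End(V))) x (u : dual V) v :
  pairing (rdual rho x u) v = pairing u (rho x v).
Proof.
rewrite /rdual bilinE; first by rewrite /pairing comp_lfunE.
split=> [y|w] c s t; apply/lfunP => z;
  rewrite add_lfunE scale_lfunE !comp_lfunE.
  by rewrite add_lfunE scale_lfunE.
by rewrite linearP add_lfunE scale_lfunE linearP.
Qed.

(* Identification of End(V^** ) with End(V) along [ev]. *)
Definition unbidual A V (rho : 'Hom(A, 'End(dual (dual V)))) : 'Hom(A, 'End(V)) :=
  bilin (fun (x : A) (v : V) => (ev V)^-1%VF (rho x (ev V v))).

Lemma unbidualE A V (rho : 'Hom(A, 'End(dual (dual V)))) x v :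
  ev V (unbidual rho x v) = rho x (ev V v).
Proof.
rewrite /unbidual bilinE ?evVK //.
by split=> [y|w] c s t; rewrite !linearP // add_lfunE scale_lfunE linearP.
Qed.

End Dual.

(* The tensor product is realised by matrices of coordinates; [tlift_unique]
   and [tliftE] below are its universal property. *)
Section Tensor.
Variable K : fieldType.
Implicit Types U V W : vectType K.

Definition tens U V : vectType K := 'M[K]_(\dim {:U}, \dim {:V}).

Definition pure U V (x : U) (y : V) : tens U V :=
  \matrix_(i, j) (coord (vbasis {:U}) i x * coord (vbasis {:V}) j y).

Lemma pure_bilinear U V : bilinear_fun (@pure U V).
Proof.
by split=> [x|y] c s t; apply/matrixP => i j;
  rewrite !mxE linearP ?mulrDl ?mulrDr ?mulrA // [_ * c]mulrC.
Qed.

Lemma pureDZl U V c (x x' : U) (y : V) :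
  pure (c *: x + x') y = c *: pure x y + pure x' y.
Proof. by case: (pure_bilinear U V) => _ /(_ y); apply. Qed.

Lemma pureDZr U V c (x : U) (y y' : V) :
  pure x (c *: y + y') = c *: pure x y + pure x y'.
Proof. by case: (pure_bilinear U V) => /(_ x) + _; apply. Qed.

Definition tlift U V W (f : U -> V -> W) : 'Hom(tens U V, W) :=
  linfun (fun t : tens U V => \sum_i \sum_j (t : 'M[K]_(_, _)) i j *:
            f (vbasis {:U})`_i (vbasis {:V})`_j).

Lemma lin_sum_basis U W (g : U -> W) : linear g ->
  forall x, g x = \sum_i coord (vbasis {:U}) i x *: g (vbasis {:U})`_i.
Proof.
move=> lg x; rewrite -(linfunE_of lg) [in LHS](coord_vbasis (memvf x)).
by rewrite linear_sum; apply: eq_bigr => i _; rewrite linearZ /= linfunE_of.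
Qed.

Lemma tlift_linear U V W (f : U -> V -> W) : linear (fun t : tens U V =>
  \sum_i \sum_j (t : 'M[K]_(_, _)) i j *: f (vbasis {:U})`_i (vbasis {:V})`_j).
Proof.
move=> c s t; rewrite scaler_sumr -big_split /=; apply: eq_bigr => i _.
rewrite scaler_sumr -big_split /=; apply: eq_bigr => j _.
by rewrite !mxE scalerDl scalerA.
Qed.

Lemma tliftE U V W (f : U -> V -> W) :
  bilinear_fun f -> forall x y, tlift f (pure x y) = f x y.
Proof.
move=> [lr ll] x y; rewrite /tlift linfunE_of; last exact: tlift_linear.
rewrite (lin_sum_basis (ll y) x); apply: eq_bigr => i _.
rewrite (lin_sum_basis (lr _) y) scaler_sumr; apply: eq_bigr => j _.
by rewrite mxE scalerA.
Qed.

Lemma tlift_unique U V W (g h : 'Hom(tens U V, W)) :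
  (forall x y, g (pure x y) = h (pure x y)) -> g = h.
Proof.
move=> gh; apply/lfunP => t; rewrite [t]matrix_sum_delta !linear_sum /=.
apply: eq_bigr => i _; rewrite !linear_sum; apply: eq_bigr => j _.
rewrite !linearZ /=; congr (_ *: _).
suff -> : delta_mx i j = pure (vbasis {:U})`_i (vbasis {:V})`_j by exact: gh.
apply/matrixP => p q.
rewrite !mxE !coord_free ?(basis_free (vbasisP _)) // -natrM mulnb.
by rewrite (eq_sym p) (eq_sym q).
Qed.

Definition tmap U V U' V' (f : 'Hom(U, U')) (g : 'Hom(V, V')) :
  'Hom(tens U V, tens U' V') := tlift (fun x y => pure (f x) (g y)).

Lemma tmapE U V U' V' (f : 'Hom(U, U')) (g : 'Hom(V, V')) x y :
  tmap f g (pure x y) = pure (f x) (g y).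
Proof.
rewrite /tmap tliftE //.
by split=> [a|a] c s t /=; rewrite linearP ?pureDZl ?pureDZr.
Qed.

Definition tswap U V : 'Hom(tens U V, tens V U) := tlift (fun x y => pure y x).

Lemma tswapE U V (x : U) (y : V) : tswap U V (pure x y) = pure y x.
Proof.
by rewrite /tswap tliftE //; case: (pure_bilinear V U).
Qed.

(* (U (x) V) (x) W and U (x) (V (x) W) are distinct types here, so the
   canonical isomorphism between them has to be explicit. *)
Definition tassoc U V W : 'Hom(tens (tens U V) W, tens U (tens V W)) :=
  tlift (fun (t : tens U V) (z : W) => tlift (fun x y => pure x (pure y z)) t).

Lemma tassocE U V W (x : U) (y : V) (z : W) :
  tassoc U V W (pure (pure x y) z) = pure x (pure y z).
Proof.
have b (z' : W) : bilinear_fun (fun (x : U) (y : V) => pure x (pure y z')).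
  by split=> [a|a] c s t; rewrite /= ?pureDZl ?pureDZr.
rewrite /tassoc tliftE ?tliftE //.
split=> [t|z'] c s s'; last exact: linearP.
pose L (w : W) := tlift (fun (x : U) (y : V) => pure x (pure y w)).
suff LD : L (c *: s + s') = c *: L s + L s'.
  by rewrite -[LHS]/(L _ t) LD add_lfunE scale_lfunE.
apply: tlift_unique => x' y'.
by rewrite add_lfunE scale_lfunE /L !tliftE // !pureDZr.
Qed.

(* <a (x) b, t> for a, b in the duals of U, V. *)
Definition tpairing U V (a : dual U) (b : dual V) (t : tens U V) : K :=
  tlift (fun x y => pairing a x * pairing b y : K^o) t.

Lemma tpairingE U V (a : dual U) (b : dual V) x y :
  tpairing a b (pure x y) = pairing a x * pairing b y.
Proof.
rewrite /tpairing tliftE //.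
split=> [z|z] c s t; rewrite /pairing linearP.
  by rewrite mulrDr; congr (_ + _); rewrite /GRing.scale /= mulrCA.
by rewrite mulrDl; congr (_ + _); rewrite /GRing.scale /= mulrA.
Qed.

End Tensor.

Section Novikov.
Variable K : fieldType.
Implicit Types A B V : vectType K.

Definition binop A := 'Hom(A, 'End(A)).

Definition bullet A (lt gt : binop A) : binop A := lt + gt.

Definition novikov A (lt gt : binop A) : Prop :=
  (forall x y z, lt (gt x y) z = gt x (lt y z)) /\
  (forall x y z, bullet lt gt (lt x y) z = bullet lt gt x (gt y z)).

Definition Lmul A (op : binop A) : 'Hom(A, 'End(A)) := op.

Definition Rmul A (op : binop A) : 'Hom(A, 'End(A)) :=
  bilin (fun y x : A => op x y).

Lemma RmulE A (op : binop A) x y : Rmul op y x = op x y.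
Proof.
by rewrite /Rmul bilinE //; have [h1 h2] := hom_bilinear op; split.
Qed.

Definition bowtie A B (opA : binop A) (opB : binop B)
    (lA rA : 'Hom(A, 'End(B))) (lB rB : 'Hom(B, 'End(A))) :
    binop (A * B)%type :=
  bilin (fun u v : A * B =>
    (opA u.1 v.1 + rB v.2 u.1 + lB u.2 v.1,
     opB u.2 v.2 + lA u.1 v.2 + rA v.1 u.2)).

Lemma bowtieE A B (opA : binop A) (opB : binop B)
    (lA rA : 'Hom(A, 'End(B))) (lB rB : 'Hom(B, 'End(A))) x a y b :
  bowtie opA opB lA rA lB rB (x, a) (y, b) =
  (opA x y + rB b x + lB a y, opB a b + lA x b + rA y a).
Proof.
rewrite /bowtie bilinE // {x a y b}.
have sum3 (V : vectType K) (c : K) (p1 p2 p3 q1 q2 q3 : V) :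
    (c *: p1 + q1) + (c *: p2 + q2) + (c *: p3 + q3) =
    c *: (p1 + p2 + p3) + (q1 + q2 + q3).
  by rewrite !scalerDr [RHS]addrACA; congr (_ + _); exact: addrACA.
split=> [[x a]|[y b]] c [s1 s2] [t1 t2] /=; apply/pair_eqP/andP;
  split; apply/eqP => /=;
  by rewrite !linearP ?add_lfunE ?scale_lfunE sum3.
Qed.

Definition matched_pair A B (ltA gtA : binop A) (ltB gtB : binop B)
    (l_ltA r_ltA l_gtA r_gtA : 'Hom(A, 'End(B)))
    (l_ltB r_ltB l_gtB r_gtB : 'Hom(B, 'End(A))) : Prop :=
  [/\ novikov ltA gtA, novikov ltB gtB &
      novikov (bowtie ltA ltB l_ltA r_ltA l_ltB r_ltB)
              (bowtie gtA gtB l_gtA r_gtA l_gtB r_gtB)].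

Definition invariant_form A (lt gt : binop A) (Bf : 'Hom(A, dual A)) : Prop :=
  forall x y z, pairing (Bf (lt x y)) z = - pairing (Bf y) (bullet lt gt z x) /\
                - pairing (Bf y) (bullet lt gt z x) = pairing (Bf x) (gt y z).

Definition form_d A : 'Hom((A * dual A)%type, dual (A * dual A)%type) :=
  bilin (fun u v : A * dual A => pairing u.2 v.1 + pairing v.2 u.1 : K^o).

Lemma form_dE A (x y : A) (a b : dual A) :
  pairing (form_d A (x, a)) (y, b) = pairing a y + pairing b x.
Proof.
rewrite /pairing /form_d bilinE // {x y a b}; have [h1 h2] := pairing_bilinear A.
by split=> [[x a]|[y b]] c [s1 s2] [t1 t2] /=;
  rewrite h1 h2 scalerDr addrACA.
Qed.

Definition manin_triple A (ltA gtA : binop A) (ltD gtD : binop (dual A))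
    (lt gt : binop (A * dual A)%type) : Prop :=
  [/\ novikov lt gt,
      (forall x y, lt (x, 0) (y, 0) = (ltA x y, 0)) /\
      (forall x y, gt (x, 0) (y, 0) = (gtA x y, 0)),
      (forall a b, lt (0, a) (0, b) = (0, ltD a b)) /\
      (forall a b, gt (0, a) (0, b) = (0, gtD a b)) &
      invariant_form lt gt (form_d A)].

Definition linear_dual A (op : binop (dual A)) (Dl : 'Hom(A, tens A A)) : Prop :=
  forall (a b : dual A) x, tpairing a b (Dl x) = pairing (op a b) x.

Definition ecoord A (i : 'I_(\dim {:A})) : dual A :=
  linfun (coord (vbasis {:A}) i : A -> K^o).

Lemma ecoordE A i x : pairing (@ecoord A i) x = coord (vbasis {:A}) i x.
Proof. by rewrite /pairing linfunE_of // => c u v; rewrite linearP. Qed.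

Lemma ecoord_sum A (a : dual A) :
  a = \sum_(i < \dim {:A}) pairing a (vbasis {:A})`_i *: ecoord i.
Proof.
apply/lfunP => x; rewrite sum_lfunE [in LHS](coord_vbasis (memvf x)).
rewrite linear_sum; apply: eq_bigr => i _.
rewrite scale_lfunE linearZ -[ecoord i x]/(pairing (ecoord i) x) ecoordE.
exact: mulrC.
Qed.

Lemma linear_dual_exists A (op : binop (dual A)) :
  exists Dl, linear_dual op Dl.
Proof.
pose D (x : A) : tens A A :=
  \matrix_(i, j) pairing (op (ecoord i) (ecoord j)) x.
have lD : linear D.
  by move=> c x y; apply/matrixP => i j; rewrite !mxE /pairing linearP.
exists (linfun D) => a b x; rewrite linfunE_of // /tpairing /tlift.
rewrite (linfunE_of (tlift_linear (fun x y : A => pairing a x * pairing b y : K^o))).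
rewrite /pairing [in RHS](ecoord_sum a) linear_sum !sum_lfunE.
apply: eq_bigr => i _.
rewrite linearZ !scale_lfunE [in RHS](ecoord_sum b) linear_sum sum_lfunE.
rewrite scaler_sumr; apply: eq_bigr => j _.
rewrite [in RHS]linearZ /= scale_lfunE mxE /pairing /GRing.scale /=.
by rewrite mulrC mulrA.
Qed.

Lemma linear_dual_unique A (op : binop (dual A)) (Dl Dl' : 'Hom(A, tens A A)) :
  linear_dual op Dl -> linear_dual op Dl' -> Dl = Dl'.
Proof.
move=> h h'; apply/lfunP => x; apply/matrixP => i j.
have key (t : tens A A) : tpairing (ecoord i) (ecoord j) t = t i j.
  rewrite /tpairing /tlift (linfunE_of (tlift_linear (fun x y : A =>
    pairing (ecoord i) x * pairing (ecoord j) y : K^o))).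
  rewrite (bigD1 i) //= (bigD1 j) //= !ecoordE !coord_free
    ?(basis_free (vbasisP _)) // !eqxx.
  rewrite !big1 ?addr0 => [|p pi|q qj]; first by rewrite mulr1; exact: mulr1.
    rewrite big1 // => q _; rewrite !ecoordE !coord_free
      ?(basis_free (vbasisP _)) // (negPf pi) mul0r; exact: scaler0.
  rewrite !ecoordE !coord_free ?(basis_free (vbasisP _)) // (negPf qj) mulr0.
  exact: scaler0.
by rewrite -!key h h'.
Qed.

Definition novikov_coalgebra A (Dlt Dgt : 'Hom(A, tens A A)) : Prop :=
  let Db := Dlt + Dgt in
  (forall x, tassoc A A A (tmap Dgt \1%VF (Dlt x)) = tmap \1%VF Dlt (Dgt x)) /\
  (forall x, tassoc A A A (tmap Dlt \1%VF (Db x)) = tmap \1%VF Dgt (Db x)).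

Definition novikov_bialgebra A (lt gt : binop A) (Dlt Dgt : 'Hom(A, tens A A)) :
    Prop :=
  let bu := bullet lt gt in
  let Db := Dlt + Dgt in
  let id := \1%VF : 'End(A) in
  let sigma := tswap A A in
  [/\ novikov lt gt, novikov_coalgebra Dlt Dgt &
      forall x y,
      [/\ Dlt (lt x y) =
            tmap (Rmul lt y) id (Dlt x) + tmap id (Lmul bu x) (Db y),
          Dgt (gt x y) =
            tmap (Rmul bu y) id (Db x) + tmap id (Lmul gt x) (Dgt y),
          tmap id (Rmul lt y) (Db x) + sigma (tmap id (Rmul lt x) (Db y)) =
            tmap (Lmul gt y) id (Db x) + sigma (tmap (Lmul gt x) id (Db y)) &
          tmap (Lmul bu y) id (Dlt x) + sigma (tmap (Lmul bu x) id (Dlt y)) =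
            tmap id (Rmul bu y) (Dgt x) + sigma (tmap id (Rmul bu x) (Dgt y))]].

End Novikov.

(* Main.v *)
Require Import Defs.
From HB Require Import structures.
From mathcomp Require Import all_boot all_order all_algebra.
From mathcomp Require Import ring.

Set Implicit Arguments.
Unset Strict Implicit.
Unset Printing Implicit Defensive.

Import GRing.Theory.
Local Open Scope ring_scope.

(** Write B for the form <a^*, y> + <x, b^*> on the double A + A^*; it is
symmetric and nondegenerate.  The proof turns all three conditions into one
quadrilinear identity on the double.

Invariance of B under (<, >) says that B (u < v, w), - B (v, w . u) and
B (u, v > w) agree, where . is < + >.  Pairing the axiom
(x > y) < z = x > (y < z) with w and moving factors across B gives
B (w < x, y < z) = B (x > y, z > w).  Pairing (x < y) . z = x . (y > z) with w
gives B (x < y, z < w) = B (y > z, w > x), which is the same identity up to a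
cyclic relabelling.  So an invariant pair of products on the double
is a Novikov structure if and only if this identity, [quad], holds
([novikov_quad]).

(a) <-> (b): an invariant pair of products is determined by its values
on A x A and on A^* x A^* ([invariant_unique]), and the products of the decuple
in (b) are invariant ([double_invariant]) and extend the given ones.  They are
therefore the only candidates for a Manin triple.

(b) <-> (c): by multilinearity [quad] has to be tested on homogeneous elements
only, which leaves sixteen patterns, and [quad] is stable under rotation by two
places.  A pattern with three cyclically consecutive entries in A, or in A^*,
holds by one of the axioms of that subalgebra.  What remains, up to rotation,
is AADD, ADDA, DADA and ADAD, with D for an entry in A^* ([quad_double]); once
the values in A (x) A are paired with a (x) b, these are exactly
the four compatibility conditions of a bialgebra ([bialgebra1] to
[bialgebra4]).  The coalgebra axioms are the transposed axioms of the Novikov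
algebra A^* ([novikov_dual_coalgebra]). *)

(** * Separating tensors by pairings *)
Section TensorPairing.
Variable K : fieldType.
Implicit Types U V W A : vectType K.

Lemma pairingDl V (u w : dual V) v :
  pairing (u + w) v = pairing u v + pairing w v.
Proof. by rewrite /pairing add_lfunE. Qed.

Lemma pairingNl V (u : dual V) v : pairing (- u) v = - pairing u v.
Proof. by rewrite /pairing opp_lfunE. Qed.

Lemma pairing0l V v : pairing (0 : dual V) v = 0.
Proof. by rewrite /pairing zero_lfunE. Qed.

Lemma pairingDr V (u : dual V) v v' :
  pairing u (v + v') = pairing u v + pairing u v'.
Proof. by rewrite /pairing linearD. Qed.

Lemma pairingNr V (u : dual V) v : pairing u (- v) = - pairing u v.
Proof. by rewrite /pairing linearN. Qed.

Lemma pairing0r V (u : dual V) : pairing u 0 = 0.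
Proof. by rewrite /pairing linear0. Qed.

Lemma pairingZr V (u : dual V) c v : pairing u (c *: v) = c * pairing u v.
Proof. by rewrite /pairing linearZ. Qed.

Lemma pairing_comp V W (u : dual W) (f : 'Hom(V, W)) v :
  pairing (u \o f : dual V)%VF v = pairing u (f v).
Proof. by rewrite /pairing comp_lfunE. Qed.

Lemma pairing_inj V (v w : V) :
  (forall u : dual V, pairing u v = pairing u w) -> v = w.
Proof.
move=> h; apply: (can_inj (@evK K V)); apply: dualP => u.
by rewrite !evE.
Qed.

(** [tpairing a b] as an element of the dual of the tensor product, so that it
can itself be a factor in a pairing with a triple tensor. *)
Definition tensor_form U V (a : dual U) (b : dual V) : dual (tens U V) :=
  tlift (fun x y => pairing a x * pairing b y : K^o).

Lemma tensor_formE U V (a : dual U) (b : dual V) x y :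
  pairing (tensor_form a b) (pure x y) = pairing a x * pairing b y.
Proof. exact: tpairingE. Qed.

Lemma tens_dual_ext U V (f g : dual (tens U V)) :
  (forall x y, pairing f (pure x y) = pairing g (pure x y)) -> f = g.
Proof. by move=> fg; apply: tlift_unique => x y; apply: fg. Qed.

Lemma tpairingD U V (a : dual U) (b : dual V) s t :
  tpairing a b (s + t) = tpairing a b s + tpairing a b t.
Proof. exact: (@pairingDr _ (tensor_form a b)). Qed.

(** Pure forms separate tensors because they include the coordinates. *)
Lemma tpairing_ecoord U V (i : 'I_(\dim {:U})) (j : 'I_(\dim {:V}))
    (t : tens U V) :
  tpairing (ecoord i) (ecoord j) t = (t : 'M[K]_(_, _)) i j.
Proof.
rewrite /tpairing /tlift (linfunE_of (tlift_linear (fun (x : U) (y : V) =>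
  pairing (ecoord i) x * pairing (ecoord j) y : K^o))).
rewrite (bigD1 i) //= (bigD1 j) //= !ecoordE !coord_free
  ?(basis_free (vbasisP _)) // !eqxx.
rewrite !big1 ?addr0 => [|p pi|q qj]; first by rewrite mulr1; exact: mulr1.
  rewrite big1 // => q _; rewrite !ecoordE !coord_free
    ?(basis_free (vbasisP _)) // (negPf pi) mul0r; exact: scaler0.
rewrite !ecoordE !coord_free ?(basis_free (vbasisP _)) // (negPf qj) mulr0.
exact: scaler0.
Qed.

Lemma eq_tpairing U V (s t : tens U V) :
  (forall a b, tpairing a b s = tpairing a b t) -> s = t.
Proof.
by move=> h; apply/matrixP => i j; rewrite -!tpairing_ecoord h.
Qed.

(** [f] contracts the first tensor factor against [a]. *)
Lemma tpairing_contract U W (a : dual U) :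
  exists f : 'Hom(tens U W, W), forall e t, tpairing a e t = pairing e (f t).
Proof.
exists (tlift (fun x w => pairing a x *: w)) => e t.
have bl : bilinear_fun (fun x (w : W) => pairing a x *: w).
  split=> [x|w] c u v; first by rewrite scalerDr !scalerA mulrC.
  by rewrite pairingDr pairingZr scalerDl -scalerA.
rewrite -[LHS]/(pairing (tensor_form a e) t) -pairing_comp.
congr pairing; apply: tens_dual_ext => x w.
by rewrite pairing_comp tliftE // pairingZr tensor_formE.
Qed.

(** A general form on [tens V W] is not pure, but it may be evaluated after
contracting the first factor, and the contracted tensors are separated by pure
forms. *)
Lemma eq_tpairing3 U V W (s t : tens U (tens V W)) :
  (forall a b c, tpairing a (tensor_form b c) s = tpairing a (tensor_form b c) t)
  -> s = t.
Proof.
move=> h; apply: eq_tpairing => a e.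
have [f fE] := tpairing_contract (tens V W) a.
rewrite !fE; congr pairing; apply: eq_tpairing => b c.
by have := h a b c; rewrite !fE.
Qed.

Lemma tens3_dual_ext U V W (f g : dual (tens (tens U V) W)) :
  (forall x y z, pairing f (pure (pure x y) z) = pairing g (pure (pure x y) z)) ->
  f = g.
Proof.
move=> fg; apply: tens_dual_ext => s z.
have lz : linear (fun s : tens U V => pure s z).
  by move=> c u v; exact: pureDZl.
rewrite -(linfunE_of lz s) -!pairing_comp; congr pairing.
by apply: tens_dual_ext => x y; rewrite !pairing_comp !linfunE_of.
Qed.

Lemma tpairing_assoc U V W (a : dual U) (b : dual V) (c : dual W) t :
  tpairing a (tensor_form b c) (tassoc U V W t) = tpairing (tensor_form a b) c t.
Proof.
rewrite -[LHS]/(pairing (tensor_form a (tensor_form b c)) _) -pairing_comp.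
rewrite -[RHS]/(pairing (tensor_form (tensor_form a b) c) _); congr pairing.
apply: tens3_dual_ext => x y z.
by rewrite pairing_comp tassocE !tensor_formE mulrA.
Qed.

Lemma tpairing_map U V U' V' (f : 'Hom(U, U')) (g : 'Hom(V, V')) a b t :
  tpairing a b (tmap f g t) =
  tpairing (a \o f : dual U)%VF (b \o g : dual V)%VF t.
Proof.
rewrite -[LHS]/(pairing (tensor_form a b) _) -pairing_comp.
rewrite -[RHS]/(pairing (tensor_form _ _) _); congr pairing.
apply: tens_dual_ext => x y.
by rewrite pairing_comp tmapE !tensor_formE !pairing_comp.
Qed.

Lemma tpairing_swap U V (a : dual U) (b : dual V) t :
  tpairing b a (tswap U V t) = tpairing a b t.
Proof.
rewrite -[LHS]/(pairing (tensor_form b a) _) -pairing_comp.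
rewrite -[RHS]/(pairing (tensor_form _ _) _); congr pairing.
apply: tens_dual_ext => x y.
by rewrite pairing_comp tswapE !tensor_formE mulrC.
Qed.

End TensorPairing.

(** * Novikov algebras with an invariant form *)
Section Invariant.
Variables (K : fieldType) (D : vectType K) (Bf : 'Hom(D, dual D)).
Notation B u v := (pairing (Bf u) v).

(** With an invariant form, each of the two Novikov axioms takes this shape after
pairing with a fourth element. *)
Definition quad (lt gt : binop D) x y z w : Prop :=
  B (lt x y) (lt z w) = B (gt y z) (gt w x).

Lemma form_Dl u u' v : B (u + u') v = B u v + B u' v.
Proof. by rewrite linearD pairingDl. Qed.

Lemma binopDl (op : binop D) x x' y : op (x + x') y = op x y + op x' y.
Proof. by rewrite linearD add_lfunE. Qed.

Lemma binopDr (op : binop D) x y y' : op x (y + y') = op x y + op x y'.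
Proof. exact: linearD. Qed.

Hypothesis Bsym : forall u v, B u v = B v u.

Section OneStructure.
Variables lt gt : binop D.
Hypothesis Binv : invariant_form lt gt Bf.

Lemma inv_lt_gt u v w : B (lt u v) w = B u (gt v w).
Proof. by have [-> ->] := Binv u v w. Qed.

Lemma inv_lt_bullet u v w : B (lt u v) w = - B v (bullet lt gt w u).
Proof. by have [-> _] := Binv u v w. Qed.

Lemma inv_bullet u v w : B (bullet lt gt u v) w = - B (lt v w) u.
Proof. by rewrite inv_lt_bullet opprK Bsym. Qed.

(** Invariance moves the outer factor of a triple product across the form:
B ((x > y) < z, w) = B (x > y, z > w) and B (w, x > (y < z)) = B (w < x, y < z).
*)
Lemma quad1E x y z w : quad lt gt w x y z <->
  B (lt (gt x y) z) w = B (gt x (lt y z)) w.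
Proof.
rewrite /quad (inv_lt_gt (gt x y)) [B (gt x _) w]Bsym -(inv_lt_gt w).
by split=> ->.
Qed.

(** Here both sides of the axiom are of the form B (u . v, w) = - B (v < w, u).
*)
Lemma quad2E x y z w : quad lt gt x y z w <->
  B (bullet lt gt (lt x y) z) w = B (bullet lt gt x (gt y z)) w.
Proof.
rewrite /quad !inv_bullet [B (lt z w) _]Bsym (inv_lt_gt (gt y z)).
by split=> [->//|/oppr_inj].
Qed.

Lemma quad_rot x y z w : quad lt gt x y z w -> quad lt gt z w x y.
Proof. by rewrite /quad Bsym => ->; rewrite Bsym. Qed.

Lemma quad_add1 x x' y z w :
  quad lt gt x y z w -> quad lt gt x' y z w -> quad lt gt (x + x') y z w.
Proof.
rewrite /quad => h h'.
by rewrite binopDl binopDr form_Dl pairingDr h h'.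
Qed.

Lemma quad_add2 x y y' z w :
  quad lt gt x y z w -> quad lt gt x y' z w -> quad lt gt x (y + y') z w.
Proof.
rewrite /quad => h h'.
by rewrite binopDl binopDr !form_Dl h h'.
Qed.

Lemma quad_add3 x y z z' w :
  quad lt gt x y z w -> quad lt gt x y z' w -> quad lt gt x y (z + z') w.
Proof. by move=> h h'; apply/quad_rot/quad_add1; apply: quad_rot. Qed.

Lemma quad_add4 x y z w w' :
  quad lt gt x y z w -> quad lt gt x y z w' -> quad lt gt x y z (w + w').
Proof. by move=> h h'; apply/quad_rot/quad_add2; apply: quad_rot. Qed.

Hypothesis Bnondeg : forall u v, (forall w, B u w = B v w) -> u = v.

Lemma novikov_quad :
  novikov lt gt <-> forall x y z w, quad lt gt x y z w.
Proof.
split=> [[nov1 _] x y z w|q]; first by apply/quad1E; rewrite nov1.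
by split=> x y z; apply: Bnondeg => w; [apply/quad1E|apply/quad2E].
Qed.

End OneStructure.
End Invariant.

(** * Invariant structures on the sum of a space and its dual *)
Section Double.
Variables (K : fieldType) (A : vectType K).
Local Notation D := (A * dual A)%type.

Definition inA (x : A) : D := (x, 0).
Definition inD (a : dual A) : D := (0, a).

Lemma double_ind (P : D -> Prop) :
    (forall u v, P u -> P v -> P (u + v)) ->
    (forall x, P (inA x)) -> (forall a, P (inD a)) -> forall u, P u.
Proof.
move=> PD PA PDl [x a]; have -> : (x, a) = inA x + inD a.
  by apply/pair_eqP; rewrite /= addr0 add0r !eqxx.
exact: PD.
Qed.

Lemma form_d_sym (u v : D) :
  pairing (form_d A u) v = pairing (form_d A v) u.
Proof. by case: u v => [x a] [y b]; rewrite !form_dE addrC. Qed.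

Lemma form_d_nondeg (u v : D) :
  (forall w, pairing (form_d A u) w = pairing (form_d A v) w) -> u = v.
Proof.
case: u v => [x a] [y b] h; congr (_, _).
  apply: pairing_inj => c; have := h (inD c).
  by rewrite !form_dE !pairing0r !add0r.
apply: dualP => z; have := h (inA z).
by rewrite !form_dE !pairing0l !addr0.
Qed.

Section Quad.
Variables (ltA gtA : binop A) (ltD gtD : binop (dual A)).
Variables lt gt : binop D.
Hypotheses (ltAA : forall x y, lt (inA x) (inA y) = inA (ltA x y))
  (gtAA : forall x y, gt (inA x) (inA y) = inA (gtA x y))
  (ltDD : forall a b, lt (inD a) (inD b) = inD (ltD a b))
  (gtDD : forall a b, gt (inD a) (inD b) = inD (gtD a b)).
Hypothesis inv : invariant_form lt gt (form_d A).
Hypotheses (novA : novikov ltA gtA) (novD : novikov ltD gtD).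
Local Notation Q := (quad (form_d A) lt gt).

Lemma inAD x y : inA (x + y) = inA x + inA y.
Proof. by congr (_, _); rewrite addr0. Qed.

Lemma inDD a b : inD (a + b) = inD a + inD b.
Proof. by congr (_, _); rewrite addr0. Qed.

(** The entry [u] outside the subalgebra is arbitrary: the identity follows from
an axiom for the three others, the second axiom if [u] comes last and the first
one if [u] comes first. *)
Lemma quad_AAA x y z (u : D) :
  Q (inA x) (inA y) (inA z) u /\ Q u (inA x) (inA y) (inA z).
Proof.
have [n1 n2] := novA; split.
  apply/(quad2E form_d_sym inv).
  have := congr1 inA (n2 x y z).
  by rewrite !add_lfunE !ltAA !gtAA !ltAA -!inAD => ->.
by apply/(quad1E form_d_sym inv); rewrite gtAA !ltAA gtAA n1.
Qed.

Lemma quad_DDD a b c (u : D) :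
  Q (inD a) (inD b) (inD c) u /\ Q u (inD a) (inD b) (inD c).
Proof.
have [n1 n2] := novD; split.
  apply/(quad2E form_d_sym inv).
  have := congr1 inD (n2 a b c).
  by rewrite !add_lfunE !ltDD !gtDD !ltDD -!inDD => ->.
by apply/(quad1E form_d_sym inv); rewrite gtDD !ltDD gtDD n1.
Qed.

(** The four patterns that are not settled by the axioms of the summands. *)
Lemma quad_double : (forall u v w s, Q u v w s) <->
  forall x y a b, [/\ Q (inA x) (inA y) (inD a) (inD b),
    Q (inA y) (inD a) (inD b) (inA x),
    Q (inD a) (inA y) (inD b) (inA x) &
    Q (inA x) (inD a) (inA y) (inD b)].
Proof.
split=> [q x y a b|q]; first by split.
have rot := quad_rot form_d_sym.
apply: double_ind => [u u' h h' v w s|x|a];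
  first by apply: quad_add1; [apply: h|apply: h'].
all: apply: double_ind => [u u' h h' w s|y|b];
  first by apply: quad_add2; [apply: h|apply: h'].
all: apply: double_ind => [u u' h h' s|z|c];
  first by apply: quad_add3; [apply: form_d_sym|apply: h|apply: h'].
all: apply: double_ind => [u u' h h'|w|d];
  first by apply: quad_add4; [apply: form_d_sym|apply: h|apply: h'].
(* The patterns come in lexicographic order, from AAAA to DDDD. *)
- by case: (quad_AAA x y z (inA w)).
- by case: (quad_AAA x y z (inD d)).
- by apply: rot; case: (quad_AAA w x y (inD c)).
- by case: (q x y c d).
- by apply: rot; case: (quad_AAA z w x (inD b)).
- by case: (q x z b d).
- by case: (q w x b c).
- by case: (quad_DDD b c d (inA x)).
- by case: (quad_AAA y z w (inD a)).
- by apply: rot; case: (q y z d a).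
- by case: (q w y a c).
- by apply: rot; case: (quad_DDD c d a (inA y)).
- by apply: rot; case: (q z w a b).
- by apply: rot; case: (quad_DDD d a b (inA z)).
- by case: (quad_DDD a b c (inA w)).
- by case: (quad_DDD a b c (inD d)).
Qed.
End Quad.

(** Among the three arguments of the form B (u < v, w) on homogeneous elements,
two lie in the same summand.  Invariance expresses this value by the product of
those two, which is prescribed. *)
Lemma invariant_unique (lt gt lt' gt' : binop D) :
    invariant_form lt gt (form_d A) -> invariant_form lt' gt' (form_d A) ->
    (forall x y, lt (inA x) (inA y) = lt' (inA x) (inA y)) ->
    (forall x y, gt (inA x) (inA y) = gt' (inA x) (inA y)) ->
    (forall a b, lt (inD a) (inD b) = lt' (inD a) (inD b)) ->
    (forall a b, gt (inD a) (inD b) = gt' (inD a) (inD b)) ->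
  lt = lt' /\ gt = gt'.
Proof.
move=> inv inv' ltA gtA ltD gtD.
have ltE (w v u : D) :
    pairing (form_d A (lt u v)) w = pairing (form_d A (lt' u v)) w.
{ elim/double_ind: w v u => [w w' h h' v u|z|c];
    first by rewrite !pairingDr h h'.
  all: elim/double_ind=> [v v' h h' u|y|b];
    first by rewrite !binopDr !form_Dl h h'.
  all: elim/double_ind=> [u u' h h'|x|a];
    first by rewrite !binopDl !form_Dl h h'.
  - by rewrite ltA.
  - by rewrite (inv_lt_gt inv) (inv_lt_gt inv') gtA.
  - by rewrite (inv_lt_bullet inv) (inv_lt_bullet inv') !add_lfunE ltA gtA.
  - by rewrite ltD.
  - by rewrite ltA.
  - by rewrite (inv_lt_bullet inv) (inv_lt_bullet inv') !add_lfunE ltD gtD.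
  - by rewrite (inv_lt_gt inv) (inv_lt_gt inv') gtD.
  - by rewrite ltD. }
split; apply/lfunP => u; apply/lfunP => v; apply: form_d_nondeg => w //.
by rewrite form_d_sym -(inv_lt_gt inv) [RHS]form_d_sym -(inv_lt_gt inv') ltE.
Qed.

End Double.

(** * The products of the matched pair *)
Section DoubleProduct.
Variables (K : fieldType) (A : vectType K).
Local Notation D := (A * dual A)%type.

(** The identification of the bidual with [A] disappears under pairings. *)
Lemma pairing_unbidual (V : vectType K) (rho : 'Hom(V, 'End(dual A)))
    (x : A) (b : V) c :
  pairing c (unbidual (rdual rho) b x) = pairing (rho b c) x.
Proof. by rewrite -evE unbidualE rdualE evE. Qed.

Variables (ltA gtA : binop A) (ltD gtD : binop (dual A)).
Local Notation buA := (bullet ltA gtA).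
Local Notation buD := (bullet ltD gtD).

Definition double_lt : binop D :=
  bowtie ltA ltD (- rdual (Rmul buA)) (rdual (Lmul gtA))
    (- unbidual (rdual (Rmul buD))) (unbidual (rdual (Lmul gtD))).
Definition double_gt : binop D :=
  bowtie gtA gtD (rdual (Rmul ltA)) (- rdual (Lmul buA))
    (unbidual (rdual (Rmul ltD))) (- unbidual (rdual (Lmul buD))).

Lemma double_ltE x a y b : double_lt (x, a) (y, b) =
  (ltA x y + unbidual (rdual (Lmul gtD)) b x
     - unbidual (rdual (Rmul buD)) a y,
   ltD a b - rdual (Rmul buA) x b + rdual (Lmul gtA) y a).
Proof. by rewrite /double_lt bowtieE !opp_lfunE. Qed.

Lemma double_gtE x a y b : double_gt (x, a) (y, b) =
  (gtA x y - unbidual (rdual (Lmul buD)) b x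
     + unbidual (rdual (Rmul ltD)) a y,
   gtD a b + rdual (Rmul ltA) x b - rdual (Lmul buA) y a).
Proof. by rewrite /double_gt bowtieE !opp_lfunE. Qed.

(** The actions in the decuple are the ones that invariance forces: for x in A
and b in A^*, the two components of x < b are read off from
B (x < b, y) = - B (b, y . x) and B (x < b, c) = B (x, b > c), and similarly for
the other mixed products. *)
Lemma double_invariant : invariant_form double_lt double_gt (form_d A).
Proof.
move=> [x a] [y b] [z c].
rewrite !add_lfunE double_ltE !double_gtE double_ltE.
rewrite -[(_, _) + (_, _)]/(_ + _, _ + _) !form_dE.
rewrite !(pairingDl, pairingDr, pairingNl, pairingNr).
rewrite !pairing_unbidual !rdualE !RmulE /Lmul !add_lfunE.
rewrite !(pairingDl, pairingDr).
by split; ring.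
Qed.

Lemma double_ltAA x y : double_lt (inA x) (inA y) = inA (ltA x y).
Proof. by rewrite double_ltE !(linear0, zero_lfunE) ?oppr0 !addr0. Qed.

Lemma double_gtAA x y : double_gt (inA x) (inA y) = inA (gtA x y).
Proof. by rewrite double_gtE !(linear0, zero_lfunE) ?oppr0 !addr0. Qed.

Lemma double_ltDD a b : double_lt (inD a) (inD b) = inD (ltD a b).
Proof. by rewrite double_ltE !(linear0, zero_lfunE) ?oppr0 !addr0. Qed.

Lemma double_gtDD a b : double_gt (inD a) (inD b) = inD (gtD a b).
Proof. by rewrite double_gtE !(linear0, zero_lfunE) ?oppr0 !addr0. Qed.

Lemma double_ltAD x b : double_lt (inA x) (inD b) =
  (unbidual (rdual (Lmul gtD)) b x, - rdual (Rmul buA) x b).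
Proof.
by rewrite double_ltE !(linear0, zero_lfunE) ?oppr0 !addr0 !add0r.
Qed.

Lemma double_ltDA a y : double_lt (inD a) (inA y) =
  (- unbidual (rdual (Rmul buD)) a y, rdual (Lmul gtA) y a).
Proof.
by rewrite double_ltE !(linear0, zero_lfunE) ?oppr0 !addr0 !add0r.
Qed.

Lemma double_gtAD x b : double_gt (inA x) (inD b) =
  (- unbidual (rdual (Lmul buD)) b x, rdual (Rmul ltA) x b).
Proof.
by rewrite double_gtE !(linear0, zero_lfunE) ?oppr0 !addr0 !add0r.
Qed.

Lemma double_gtDA a y : double_gt (inD a) (inA y) =
  (unbidual (rdual (Rmul ltD)) a y, - rdual (Lmul buA) y a).
Proof.
by rewrite double_gtE !(linear0, zero_lfunE) ?oppr0 !addr0 !add0r.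
Qed.

(** * The bialgebra conditions *)

Variables Dlt Dgt : 'Hom(A, tens A A).
Hypotheses (Dlt_dual : linear_dual ltD Dlt) (Dgt_dual : linear_dual gtD Dgt).
Local Notation Db := (Dlt + Dgt).
Local Notation id := (\1%VF : 'End(A)).
Local Notation sigma := (tswap A A).
Local Notation Q := (quad (form_d A) double_lt double_gt).

Lemma Db_dual : linear_dual buD Db.
Proof.
move=> a b x; rewrite add_lfunE tpairingD Dlt_dual Dgt_dual.
by rewrite !add_lfunE pairingDl.
Qed.

Lemma eq_tpairingP (s t : tens A A) (P : dual A -> dual A -> Prop) :
  (forall a b, tpairing a b s = tpairing a b t <-> P a b) ->
  s = t <-> forall a b, P a b.
Proof.
move=> stP; split=> [st a b|h]; first by apply/stP; rewrite st.
by apply: eq_tpairing => a b; apply/stP.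
Qed.

Lemma tpairing_mapl (rho : 'Hom(A, 'End(A))) x a b t :
  tpairing a b (tmap (rho x) id t) = tpairing (rdual rho x a) b t.
Proof.
rewrite tpairing_map comp_lfun1r; congr (tpairing _ _ _).
by apply: dualP => v; rewrite rdualE pairing_comp.
Qed.

Lemma tpairing_mapr (rho : 'Hom(A, 'End(A))) x a b t :
  tpairing a b (tmap id (rho x) t) = tpairing a (rdual rho x b) t.
Proof.
rewrite tpairing_map comp_lfun1r; congr (tpairing _ _ _).
by apply: dualP => v; rewrite rdualE pairing_comp.
Qed.

Let transposeE := (tpairingD, tpairing_swap, tpairing_mapl, tpairing_mapr,
  Db_dual, Dlt_dual, Dgt_dual).

(** Each compatibility condition, paired with a (x) b, has the terms of one
pattern of [quad]: the maps on A in the condition are transposed onto [a] and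
[b], and the form on the double adds up the A- and the A^*-components. *)
Lemma bialgebra1 x y :
  Dlt (ltA x y) =
    tmap (Rmul ltA y) id (Dlt x) + tmap id (Lmul buA x) (Db y) <->
  forall a b, Q (inA x) (inA y) (inD a) (inD b).
Proof.
apply: eq_tpairingP => a b; rewrite /quad !transposeE.
rewrite double_ltAA double_ltDD double_gtAD double_gtDA !form_dE.
rewrite pairing0l add0r pairingNl pairingNr opprK !pairing_unbidual RmulE.
by split=> ->.
Qed.

Lemma bialgebra2 x y :
  Dgt (gtA x y) =
    tmap (Rmul buA y) id (Db x) + tmap id (Lmul gtA x) (Dgt y) <->
  forall a b, Q (inA y) (inD a) (inD b) (inA x).
Proof.
apply: eq_tpairingP => a b; rewrite /quad !transposeE.
rewrite double_ltAD double_ltDA double_gtAA double_gtDD !form_dE.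
rewrite pairing0l addr0 pairingNl pairingNr opprK !pairing_unbidual RmulE.
by split=> ->.
Qed.

Lemma bialgebra3 x y :
  tmap id (Rmul ltA y) (Db x) + sigma (tmap id (Rmul ltA x) (Db y)) =
    tmap (Lmul gtA y) id (Db x) + sigma (tmap (Lmul gtA x) id (Db y)) <->
  forall a b, Q (inD a) (inA y) (inD b) (inA x).
Proof.
apply: eq_tpairingP => a b; rewrite /quad !transposeE.
rewrite !double_ltDA !double_gtAD !form_dE !pairingNr !pairing_unbidual !RmulE.
by rewrite -!opprD; split=> [->|/oppr_inj ->].
Qed.

Lemma bialgebra4 x y :
  tmap (Lmul buA y) id (Dlt x) + sigma (tmap (Lmul buA x) id (Dlt y)) =
    tmap id (Rmul buA y) (Dgt x) + sigma (tmap id (Rmul buA x) (Dgt y)) <->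
  forall a b, Q (inA x) (inD a) (inA y) (inD b).
Proof.
apply: eq_tpairingP => a b; rewrite /quad !transposeE.
rewrite !double_ltAD !double_gtDA !form_dE !pairingNl !pairing_unbidual !RmulE.
by rewrite -!opprD [X in - X = _]addrC; split=> [->|/oppr_inj ->].
Qed.

(** Evaluates a comultiplication applied inside one factor of a triple tensor. *)
Lemma tensor_form_dual (op : binop (dual A)) Dl : linear_dual op Dl ->
  forall a b, (tensor_form a b \o Dl)%VF = op a b.
Proof.
by move=> dl a b; apply: dualP => x; rewrite pairing_comp -(dl a b x).
Qed.

Lemma novikov_dual_coalgebra : novikov ltD gtD -> novikov_coalgebra Dlt Dgt.
Proof.
move=> [n1 n2]; split=> x; apply: eq_tpairing3 => a b c;
  rewrite tpairing_assoc !tpairing_map !comp_lfun1r.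
  by rewrite (tensor_form_dual Dgt_dual) (tensor_form_dual Dlt_dual)
    Dlt_dual Dgt_dual n1.
by rewrite (tensor_form_dual Dlt_dual) (tensor_form_dual Dgt_dual)
  !Db_dual n2.
Qed.

End DoubleProduct.

Theorem theorem2p16 (K : fieldType) (charK0 : [pchar K] =i pred0)
  (A : vectType K) (ltA gtA : binop A) (ltD gtD : binop (dual A))
  (novA : novikov ltA gtA) (novD : novikov ltD gtD)
  (Dlt Dgt : 'Hom(A, tens A A))
  (Dlt_dual : linear_dual ltD Dlt) (Dgt_dual : linear_dual gtD Dgt) :
  let buA := bullet ltA gtA in
  let buD := bullet ltD gtD in
  let manin := exists lt gt : binop (A * dual A)%type,
    manin_triple ltA gtA ltD gtD lt gt in
  let matched := matched_pair ltA gtA ltD gtD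
    (- rdual (Rmul buA)) (rdual (Lmul gtA))
    (rdual (Rmul ltA)) (- rdual (Lmul buA))
    (- unbidual (rdual (Rmul buD))) (unbidual (rdual (Lmul gtD)))
    (unbidual (rdual (Rmul ltD))) (- unbidual (rdual (Lmul buD))) in
  let bialg := novikov_bialgebra ltA gtA Dlt Dgt in
  (manin <-> matched) /\ (matched <-> bialg).
Proof.
move=> buA buD manin matched bialg.
pose lt := double_lt ltA gtA ltD gtD; pose gt := double_gt ltA gtA ltD gtD.
have inv : invariant_form lt gt (form_d A) by exact: double_invariant.
have matchedE : matched <-> novikov lt gt by split=> [[]|nov].
split.
  rewrite matchedE; split=> [[lt' [gt' [nov [lAA gAA] [lDD gDD] inv']]]|nov].
    have [||||<- <- //] := invariant_unique inv' inv.
    - by move=> x y; rewrite lAA double_ltAA.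
    - by move=> x y; rewrite gAA double_gtAA.
    - by move=> a b; rewrite lDD double_ltDD.
    - by move=> a b; rewrite gDD double_gtDD.
  exists lt, gt; split=> //; split=> *.
  - exact: double_ltAA.
  - exact: double_gtAA.
  - exact: double_ltDD.
  - exact: double_gtDD.
rewrite matchedE (novikov_quad (@form_d_sym K A) inv (@form_d_nondeg K A)).
rewrite (quad_double (double_ltAA _ _ _ _) (double_gtAA _ _ _ _)
  (double_ltDD _ _ _ _) (double_gtDD _ _ _ _) inv novA novD).
split=> [q|[_ _ c] x y a b].
  split=> // [|x y]; first exact: novikov_dual_coalgebra.
  by split; [apply/(bialgebra1 ltA gtA Dlt_dual Dgt_dual) => a b
            |apply/(bialgebra2 ltA gtA Dlt_dual Dgt_dual) => a b
            |apply/(bialgebra3 ltA gtA Dlt_dual Dgt_dual) => a b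
            |apply/(bialgebra4 ltA gtA Dlt_dual Dgt_dual) => a b];
    have [] := q x y a b.
have [c1 c2 c3 c4] := c x y.
move/(bialgebra1 ltA gtA Dlt_dual Dgt_dual): c1 => c1.
move/(bialgebra2 ltA gtA Dlt_dual Dgt_dual): c2 => c2.
move/(bialgebra3 ltA gtA Dlt_dual Dgt_dual): c3 => c3.
move/(bialgebra4 ltA gtA Dlt_dual Dgt_dual): c4 => c4.
by split.
Qed.
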